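(* Let $B_{end}$ be the set $B$ of labeled polynomials at the end of a terminating execution of the natural variation of the F5M algorithm (which uses the term-over-position order $\prec'$ on signatures and the notion of new-comparable). Let $\mathcal F=(x^\alpha\mathbf e_j,f,k_f)\in B_{end}$ be a labeled polynomial and $cx^\gamma$ a non-zero monomial. If $cx^\gamma\mathcal F$ is new-comparable by $B_{end}$, then $cx^\gamma\mathcal F$ has a strictly lower representation w.r.t. $B_{end}$ (with respect to $\rhd'$).
   Context: **Basics.** $K$ is a field, $K[X]=K[x_1,\dots,x_n]$, $PP(X)$ is the set of power products $x^\alpha$, $\alpha\in\mathbb N^n$, and $\prec$ is an admissible (monomial) order on $PP(X)$. For $0\ne f\in K[X]$, $\mathrm{lpp}(f)$, $\mathrm{lc}(f)$, $\mathrm{lm}(f)=\mathrm{lc}(f)\mathrm{lpp}(f)$ are the leading power product, coefficient and monomial. Convention: $\mathrm{lpp}(0)=0$, which is strictly smaller than every power product (and than every signature) and divides no power product. ''Monomial'' means $cx^\gamma$ with $c\in K$, $c\neq0$. **Signatures.** Fix $(f_1,\dots,f_m)\in (K[X])^m$ with all $f_i\ne0$ (the initial polynomials). Let $\mathbf e_i$ be the $i$-th unit vector of $(K[X])^m$ and $\sigma(g_1,\dots,g_m)=g_1f_1+\cdots+g_mf_m$. Order the $x^\alpha\mathbf e_i$ by: $x^\alpha\mathbf e_i\prec' x^\beta\mathbf e_j$ iff $x^\alpha\mathrm{lpp}(f_i)\prec x^\beta\mathrm{lpp}(f_j)$, or $x^\alpha\mathrm{lpp}(f_i)=x^\beta\mathrm{lpp}(f_j)$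 and $i>j$. $x^\alpha\mathbf e_i$ is a signature of $g$ if there is $\mathbf g\in(K[X])^m$ with $\sigma(\mathbf g)=g$ and leading power product (w.r.t. $\prec'$) $x^\alpha\mathbf e_i$. **Labeled polynomials.** $L[X]$ is the set of triples $\mathcal G=(x^\alpha\mathbf e_i,g,k)$ with $x^\alpha\mathbf e_i$ a signature of $g\in\langle f_1,\dots,f_m\rangle$ and $k\in\mathbb N$. Write $\mathrm{Sign}(\mathcal G)=x^\alpha\mathbf e_i$, $\mathrm{Poly}(\mathcal G)=g$, $\mathrm{Num}(\mathcal G)=k$, $\mathrm{lpp}(\mathcal G)=\mathrm{lpp}(g)$, $\mathrm{lm}(\mathcal G)=\mathrm{lm}(g)$. For $p\in K[X]$, $p\mathcal G=(\mathrm{lpp}(p)x^\alpha\mathbf e_i,pg,k)$. Subtracting from $\mathcal F$ a labeled polynomial of strictly smaller signature subtracts the polynomial parts and keeps the signature and number of $\mathcal F$. Write $\mathcal F\lhd'\mathcal G$ (or $\mathcal G\rhd'\mathcal F$) iff $\mathrm{Sign}(\mathcal F)\prec'\mathrm{Sign}(\mathcal G)$, or the signatures are equal and $\mathrm{Num}(\mathcal F)>\mathrm{Num}(\mathcal G)$. **Critical pairs.** For labeled polynomials $\mathcal F,\mathcal G$ with nonzero polynomial parts, the critical pair $[\mathcal F,\mathcal G]=(u,\mathcal F,v,\mathcal G)$ consists of monomials $u,v$ with $u\,\mathrm{lm}(\mathcal F)=v\,\mathrm{lm}(\mathcal G)=\mathrm{lcm}(\mathrm{lpp}(\mathcal F),\mathrm{lpp}(\mathcal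 G))$, the two entries being ordered so that $u\mathcal F\rhd' v\mathcal G$. Its s-polynomial is $u\mathcal F-v\mathcal G=(\mathrm{Sign}(u\mathcal F),\,u\mathrm{Poly}(\mathcal F)-v\mathrm{Poly}(\mathcal G),\,\mathrm{Num}(\mathcal F))$. **Criteria.** Let $B\subset L[X]$, $\mathcal F=(x^\alpha\mathbf e_i,f,k_f)$ and $cx^\gamma$ a monomial. $cx^\gamma\mathcal F$ is *new-comparable* by $B$ if some $\mathcal G=(x^\beta\mathbf e_j,g,k_g)\in B$ satisfies $\mathrm{lpp}(g)\mid x^{\gamma+\alpha}$ and $cx^\gamma\mathcal F\rhd' x^\lambda\mathrm{lpp}(f_i)\mathcal G$, where $x^\lambda=x^{\gamma+\alpha}/\mathrm{lpp}(g)$ (here $i$ is the index in the signature of $\mathcal F$). It is *rewritable* by $B$ if some $(x^\beta\mathbf e_i,g,k_g)\in B$ satisfies $x^\beta\mid x^{\gamma+\alpha}$ and $k_f<k_g$. A critical pair $(u,\mathcal F,v,\mathcal G)$ meets the Syzygy (resp. Rewritten) Criterion w.r.t. $B$ if $u\mathcal F$ or $v\mathcal G$ is new-comparable (resp. rewritable) by $B$. **F5-reduction.** $\mathcal F$ is F5-reducible by $B$ if there is $\mathcal G\in B$ with (1) $\mathrm{lpp}(\mathcal G)\mid\mathrm{lpp}(\mathcal F)$; put $x^\gamma=\mathrm{lpp}(\mathcal F)/\mathrm{lpp}(\mathcal G)$, $c=\mathrm{lc}(\mathrm{Poly}(\mathcal F))/\mathrm{lc}(\mathrm{Poly}(\mathcal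 G))$; (2) $\mathrm{Sign}(\mathcal F)\succ'\mathrm{Sign}(cx^\gamma\mathcal G)$; (3) $x^\gamma\mathcal G$ is not new-comparable by $B$; (4) $x^\gamma\mathcal G$ is not rewritable by $B$. One step replaces $\mathcal F$ by $\mathcal F-cx^\gamma\mathcal G$; F5-reducing $\mathcal F$ by $B$ means repeating such steps until the result is not F5-reducible by $B$. **The algorithm (natural variation of F5M).** Initialize $\mathcal F_i=(\mathbf e_i,f_i,i)$ for $1\le i\le m$, $k=m$, $B=\{\mathcal F_1,\dots,\mathcal F_m\}$, $D=\emptyset$, $CP=\{[\mathcal F_i,\mathcal F_j]\mid 1\le i<j\le m\}$. While $CP\ne\emptyset$: select (by any strategy) and remove some $cp$ from $CP$. If $cp$ meets neither criterion w.r.t. the current $B$: F5-reduce its s-polynomial by $B$ to some $\mathcal P$; set $\mathrm{Num}(\mathcal P)=k+1$; if $\mathrm{Poly}(\mathcal P)\ne0$, add to $CP$ all critical pairs $[\mathcal P,\mathcal Q]$, $\mathcal Q\in B$; set $k\leftarrow k+1$ and $B\leftarrow B\cup\{\mathcal P\}$ (whether or not $\mathrm{Poly}(\mathcal P)=0$). Otherwise $D\leftarrow D\cup\{cp\}$. (Critical pairs are only formed between labeled polynomials with nonzero polynomial parts.) **Strictly lower representation.** $\mathcal F$ has a strictly lower representation w.r.t. $B$ if there are $p_1,\dots,p_s\in K[X]$ and $\mathcal G_1,\dots,\mathcal G_s\in B$ with $\mathrm{Poly}(\mathcal F)=p_1\mathrm{Poly}(\mathcal G_1)+\cdots+p_s\mathrm{Poly}(\mathcal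 G_s)$ and $\mathcal F\rhd' p_i\mathcal G_i$ for all $i$ (terms with $p_i=0$ impose no condition). *)

(* Defs.v *)
From HB Require Import structures.
From mathcomp Require Import all_boot all_order all_algebra.
From mathcomp Require Import finmap mpoly.
From Stdlib Require Import Relations.Relation_Operators.

Set Implicit Arguments.
Unset Strict Implicit.
Unset Printing Implicit Defensive.

Import GRing.Theory.

Local Open Scope ring_scope.
Local Open Scope fset_scope.

(* [le] is the non-strict version of the order on power products. *)
Record admissible_order (n : nat) (le : rel 'X_{1..n}) : Prop := AdmissibleOrder {
  ao_antisym : antisymmetric le;
  ao_trans : transitive le;
  ao_total : total le;
  ao_min : forall a, le 0%MM a;
  ao_add : forall a b c, le a b -> le (c + a)%MM (c + b)%MM }.

Definition mlt (n : nat) (le : rel 'X_{1..n}) : rel 'X_{1..n} :=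
  fun a b => (a != b) && le a b.

(* The signature x^a e_i is the pair (a, i). *)
Definition signature (n m : nat) : Type := ('X_{1..n} * 'I_m)%type.

(* Bare triples; the labeled polynomials L[X] are those satisfying [labeled]
   below, and [f5m_output_labeled] shows that the algorithm stays in L[X]. *)
Record lpoly (n m : nat) (K : fieldType) : Type := LPoly {
  Sign : signature n m;
  Poly : {mpoly K[n]};
  Num : nat }.

Definition lpoly_tuple (n m : nat) (K : fieldType) (F : lpoly n m K) :
  ('X_{1..n} * 'I_m * {mpoly K[n]} * nat)%type := (Sign F, Poly F, Num F).
Definition tuple_lpoly (n m : nat) (K : fieldType)
  (t : ('X_{1..n} * 'I_m * {mpoly K[n]} * nat)%type) : lpoly n m K :=
  LPoly t.1.1 t.1.2 t.2.
Lemma lpoly_tupleK (n m : nat) (K : fieldType) :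
  cancel (@lpoly_tuple n m K) (@tuple_lpoly n m K).
Proof. by case. Qed.
HB.instance Definition _ (n m : nat) (K : fieldType) :=
  Choice.copy (lpoly n m K) (can_type (@lpoly_tupleK n m K)).

(* A monomial c x^a is the pair (c, a), with c != 0. *)
Definition mono (n : nat) (K : fieldType) (u : K * 'X_{1..n}) : {mpoly K[n]} :=
  u.1 *: 'X_[u.2].

Record cpair (n m : nat) (K : fieldType) : Type := CPair {
  cp_u : K * 'X_{1..n};
  cp_F : lpoly n m K;
  cp_v : K * 'X_{1..n};
  cp_G : lpoly n m K }.

Definition cpair_tuple (n m : nat) (K : fieldType) (p : cpair n m K) :
  (K * 'X_{1..n} * lpoly n m K * (K * 'X_{1..n}) * lpoly n m K)%type :=
  (cp_u p, cp_F p, cp_v p, cp_G p).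
Definition tuple_cpair (n m : nat) (K : fieldType)
  (t : (K * 'X_{1..n} * lpoly n m K * (K * 'X_{1..n}) * lpoly n m K)%type) :
  cpair n m K := CPair t.1.1.1 t.1.1.2 t.1.2 t.2.
Lemma cpair_tupleK (n m : nat) (K : fieldType) :
  cancel (@cpair_tuple n m K) (@tuple_cpair n m K).
Proof. by case. Qed.
HB.instance Definition _ (n m : nat) (K : fieldType) :=
  Choice.copy (cpair n m K) (can_type (@cpair_tupleK n m K)).

Record f5m_state (n m : nat) (K : fieldType) : Type := F5MState {
  st_B : {fset lpoly n m K};
  st_D : {fset cpair n m K};
  st_CP : {fset cpair n m K};
  st_k : nat }.

Section F5M.

Variables (n m : nat) (K : fieldType).
Variables (le : rel 'X_{1..n}) (f : 'I_m -> {mpoly K[n]}).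

Implicit Types (p : {mpoly K[n]}) (a c : 'X_{1..n}) (s t : signature n m).
Implicit Types (F G P Q : lpoly n m K) (B : {fset lpoly n m K}).
Implicit Types (u v : K * 'X_{1..n}) (cp : cpair n m K) (st : f5m_state n m K).

(* Junk value 0%MM, i.e. the power product 1, when p = 0. Every use below
   where p might vanish is guarded by an explicit p != 0, which implements the
   convention that lpp(0) is below all power products and divides none. *)
Definition lpp p : 'X_{1..n} :=
  \big[(fun a b => if le a b then b else a)/0%MM]_(a <- msupp p) a.

Definition lc p : K := p@_(lpp p).

Definition slt : rel (signature n m) := fun s t =>
  let x := (s.1 + lpp (f s.2))%MM in
  let y := (t.1 + lpp (f t.2))%MM in
  mlt le x y || ((x == y) && (t.2 < s.2)%N).

Definition sigma (h : 'I_m -> {mpoly K[n]}) : {mpoly K[n]} :=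
  \sum_(i < m) h i * f i.

Definition is_lead (h : 'I_m -> {mpoly K[n]}) s : Prop :=
  s.1 \in msupp (h s.2) /\
  forall t, t.1 \in msupp (h t.2) -> t <> s -> slt t s.

Definition is_signature s p : Prop :=
  exists h : 'I_m -> {mpoly K[n]}, sigma h = p /\ is_lead h s.

Definition labeled F : Prop := is_signature (Sign F) (Poly F).

(* Only meant for p != 0. *)
Definition lmul p F : lpoly n m K :=
  LPoly ((lpp p + (Sign F).1)%MM, (Sign F).2) (p * Poly F) (Num F).

(* Only meant for Sign G strictly below Sign F. *)
Definition lsub F G : lpoly n m K :=
  LPoly (Sign F) (Poly F - Poly G) (Num F).

Definition llt F G : bool :=
  slt (Sign F) (Sign G) || ((Sign F == Sign G) && (Num G < Num F)%N).

Definition new_comparable B u F : Prop :=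
  let a := (u.2 + (Sign F).1)%MM in
  exists2 G, G \in B &
    [/\ Poly G != 0,
        (lpp (Poly G) <= a)%MM &
        llt (lmul 'X_[(a - lpp (Poly G)) + lpp (f (Sign F).2)] G)
            (lmul (mono u) F)].

Definition rewritable B u F : Prop :=
  exists2 G, G \in B &
    [/\ (Sign G).2 = (Sign F).2,
        ((Sign G).1 <= u.2 + (Sign F).1)%MM &
        (Num F < Num G)%N].

(* Only meant for F and G with nonzero polynomial parts. *)
Definition crit_pair F G : cpair n m K :=
  let x := mlcm (lpp (Poly F)) (lpp (Poly G)) in
  let u := ((lc (Poly F))^-1, (x - lpp (Poly F))%MM) in
  let v := ((lc (Poly G))^-1, (x - lpp (Poly G))%MM) in
  if llt (lmul (mono v) G) (lmul (mono u) F)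
  then CPair u F v G else CPair v G u F.

Definition spoly cp : lpoly n m K :=
  lsub (lmul (mono (cp_u cp)) (cp_F cp)) (lmul (mono (cp_v cp)) (cp_G cp)).

Definition syzygy_criterion B cp : Prop :=
  new_comparable B (cp_u cp) (cp_F cp) \/ new_comparable B (cp_v cp) (cp_G cp).

Definition rewritten_criterion B cp : Prop :=
  rewritable B (cp_u cp) (cp_F cp) \/ rewritable B (cp_v cp) (cp_G cp).

Definition quot_mono F G : K * 'X_{1..n} :=
  (lc (Poly F) / lc (Poly G), (lpp (Poly F) - lpp (Poly G))%MM).

Definition f5_reducer B F G : Prop :=
  let cg := quot_mono F G in
  [/\ G \in B,
      [/\ Poly F != 0, Poly G != 0 & (lpp (Poly G) <= lpp (Poly F))%MM],
      slt (Sign (lmul (mono cg) G)) (Sign F),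
      ~ new_comparable B (1, cg.2) G &
      ~ rewritable B (1, cg.2) G].

Definition f5_reducible B F : Prop := exists G, f5_reducer B F G.

Definition f5_red_step B F P : Prop :=
  exists2 G, f5_reducer B F G & P = lsub F (lmul (mono (quot_mono F G)) G).

Definition f5_reduces B F P : Prop :=
  clos_refl_trans _ (f5_red_step B) F P /\ ~ f5_reducible B P.

(* x^0 e_i, f_i, i; the indices i : 'I_m start at 0. *)
Definition init_lpoly (i : 'I_m) : lpoly n m K := LPoly (0%MM, i) (f i) i.+1.

Definition f5m_init : f5m_state n m K :=
  F5MState [fset init_lpoly i | i : 'I_m] fset0
    [fset crit_pair (init_lpoly i) (init_lpoly j)
      | i : 'I_m, j : 'I_m & ((i : 'I_m) < j)%N] m.

Inductive f5m_step : f5m_state n m K -> f5m_state n m K -> Prop :=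
| F5MDiscard B D CP k cp :
    cp \in CP ->
    syzygy_criterion B cp \/ rewritten_criterion B cp ->
    f5m_step (F5MState B D CP k) (F5MState B (cp |` D) (CP `\ cp) k)
| F5MReduce B D CP k cp R :
    cp \in CP ->
    ~ syzygy_criterion B cp -> ~ rewritten_criterion B cp ->
    f5_reduces B (spoly cp) R ->
    let P := LPoly (Sign R) (Poly R) k.+1 in
    f5m_step (F5MState B D CP k)
      (F5MState (P |` B) D
         (if Poly P != 0
          then (CP `\ cp) `|` [fset crit_pair P Q | Q in B & Poly Q != 0]
          else CP `\ cp)
         k.+1).

(* B is the final set of some terminating execution. *)
Definition f5m_output B : Prop :=
  exists2 st, clos_refl_trans _ f5m_step f5m_init st &
    st_CP st = fset0 /\ st_B st = B.

Definition strictly_lower_representation B F : Prop :=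
  exists (s : nat) (p : 'I_s -> {mpoly K[n]}) (G : 'I_s -> lpoly n m K),
    [/\ forall i, G i \in B,
        Poly F = \sum_(i < s) p i * Poly (G i) &
        forall i, p i != 0 -> llt (lmul (p i) (G i)) F].

Hypothesis le_adm : admissible_order le.

Lemma mlt_trans : transitive (mlt le).
Proof.
move=> b a c /andP[nab lab] /andP[nbc lbc]; rewrite /mlt (ao_trans le_adm lab lbc).
rewrite andbT; apply: contraNN nab => /eqP eac; apply/eqP.
by apply: (ao_antisym le_adm); rewrite lab eac lbc.
Qed.

Lemma mltD c a b : mlt le a b -> mlt le (c + a)%MM (c + b)%MM.
Proof. by case/andP=> n_ab l_ab; rewrite /mlt eqm_add2l n_ab (ao_add le_adm). Qed.

Lemma slt_trans : transitive slt.
Proof.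
move=> t s r; rewrite /slt; case/orP=> [st|/andP[/eqP-> ij]].
  case/orP=> [tr|/andP[/eqP<- _]]; last by rewrite st.
  by rewrite (mlt_trans st tr).
case/orP=> [->//|/andP[-> jk]]; by rewrite (ltn_trans jk ij) orbT.
Qed.

Lemma sltD c s t :
  slt s t -> slt ((c + s.1)%MM, s.2) ((c + t.1)%MM, t.2).
Proof.
rewrite /slt /= -!addmA eqm_add2l => /orP[/(mltD c)->//|->]; exact: orbT.
Qed.

Lemma lpp_mono u : u.1 != 0 -> lpp (mono u) = u.2.
Proof.
move=> u_neq0; rewrite /lpp /mono msuppMCX // big_cons big_nil.
case: ifP => // u0; apply: (ao_antisym le_adm).
by rewrite u0 (ao_min le_adm).
Qed.

Lemma msupp_monoM u p a :
  u.1 != 0 -> ((u.2 + a)%MM \in msupp (mono u * p)) = (a \in msupp p).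
Proof.
move=> u_neq0; rewrite !mcoeff_msupp /mono -scalerAl mcoeffZ [_ * p]mulrC.
by rewrite mcoeffMX mulf_eq0 (negPf u_neq0).
Qed.

Lemma msupp_monoM_ex u p b :
  b \in msupp (mono u * p) -> exists2 a, a \in msupp p & b = (u.2 + a)%MM.
Proof.
move/msuppM_le=> /allpairsP[[x y] /= [xu yp ->]]; exists y => //.
by move/msuppZ_le: xu; rewrite msuppX inE => /eqP->.
Qed.

Lemma labeled_lmul u F : u.1 != 0 -> labeled F -> labeled (lmul (mono u) F).
Proof.
move=> u_neq0 [h [hs [hF hlt]]]; exists (fun i => mono u * h i); split.
  rewrite /= -hs /sigma mulr_sumr; by apply: eq_bigr => i _; rewrite mulrA.
rewrite /is_lead /lmul /= (lpp_mono u_neq0) (msupp_monoM _ _ u_neq0).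
split=> // -[b i] /= /msupp_monoM_ex[a ah ->] ne.
apply: (@sltD u.2 (a, i)); apply: (hlt (a, i)) => // e.
by apply: ne; rewrite -e.
Qed.

Lemma slt_irr s : slt s s = false.
Proof. by rewrite /slt /mlt eqxx ltnn. Qed.

Lemma labeled_lsub F G :
  labeled F -> labeled G -> slt (Sign G) (Sign F) -> labeled (lsub F G).
Proof.
move=> [h [hF [hs hlt]]] [h' [hG [hs' hlt']]] GF.
have lt' t : t.1 \in msupp (h' t.2) -> slt t (Sign F).
  move=> th'; case: (eqVneq t (Sign G)) => [->//|/eqP ne].
  exact: slt_trans (hlt' _ th' ne) GF.
exists (fun i => h i - h' i); split.
  rewrite /sigma /= -hF -hG /sigma -sumrB; apply: eq_bigr => i _.
  by rewrite mulrBl.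
split=> /=.
  rewrite mcoeff_msupp mcoeffB (memN_msupp_eq0 (p := h' _)) ?subr0 -?mcoeff_msupp //.
  by apply/negP=> /lt'; rewrite slt_irr.
move=> t /msuppB_le; rewrite mem_cat => /orP[th|/lt'//].
by apply: hlt.
Qed.

Lemma labeled_init i : labeled (init_lpoly i).
Proof.
exists (fun j => (j == i)%:R); split.
  rewrite /sigma (bigD1 i) //= eqxx mul1r big1 ?addr0 // => j /negPf->.
  by rewrite mul0r.
split=> /=; first by rewrite eqxx mcoeff_msupp mcoeff1 eqxx oner_neq0.
move=> [a j] /=; case: eqP => [->|_]; last by rewrite mcoeff_msupp mcoeff0 eqxx.
by rewrite mcoeff_msupp mcoeff1; case: (eqVneq a 0%MM) => [-> //|]; rewrite eqxx.
Qed.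

Lemma lpp_prop p : p != 0 ->
  lpp p \in msupp p /\ forall a, a \in msupp p -> le a (lpp p).
Proof.
rewrite -msupp_eq0 /lpp; elim: (msupp p) => //= a [|b l] IH _.
  rewrite big_cons big_nil inE; case: ifP => [a0|_].
    have -> : a = 0%MM by apply: (ao_antisym le_adm); rewrite a0 (ao_min le_adm).
    rewrite eqxx; split=> // b; rewrite inE => /eqP->.
    exact: ao_min le_adm _.
  rewrite eqxx; split=> // b; rewrite inE => /eqP->.
  by have := ao_total le_adm a a; rewrite orbb.
have{IH}[// | x_in x_max] := IH.
rewrite big_cons; set x := (X in if le a X then X else a) in x_in x_max *.
have xx : le a a by have := ao_total le_adm a a; rewrite orbb.
case: ifPn => [ax|nax].
  by rewrite in_cons x_in orbT; split=> // c; rewrite in_cons => /orP[/eqP->|/x_max].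
rewrite mem_head; split=> // c; rewrite in_cons => /orP[/eqP->//|/x_max cx].
apply: (ao_trans le_adm cx); have := ao_total le_adm a x.
by rewrite (negPf nax).
Qed.

Lemma lc_neq0 p : p != 0 -> lc p != 0.
Proof. by case/lpp_prop; rewrite mcoeff_msupp. Qed.

Lemma slt_total s t : [|| slt s t, slt t s | s == t].
Proof.
case: s t => [a i] [b j]; rewrite /slt /mlt /=.
set x := (a + _)%MM; set y := (b + _)%MM.
rewrite [y == x]eq_sym; case: (eqVneq x y) => [xy|_] /=; last first.
  by rewrite !orbF orbA (ao_total le_adm).
case: ltngtP => //= /val_inj ji; rewrite ji -pair_eqE /= eqxx andbT.
by move: xy; rewrite /x /y ji => /eqP; rewrite addmC [(b + _)%MM]addmC eqm_add2l.
Qed.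

Lemma labeled_f5_red B F P :
  (forall G, G \in B -> labeled G) ->
  clos_refl_trans _ (f5_red_step B) F P -> labeled F -> labeled P.
Proof.
move=> LB; elim=> [{}F {}P [G [GB [F0 G0 _] GF _ _] ->] LF|//|x y z _ IH1 _ IH2 /IH1/IH2//].
apply: labeled_lsub => //; apply: labeled_lmul; last exact: LB.
by rewrite /quot_mono /= mulf_neq0 ?invr_neq0 ?lc_neq0.
Qed.

Definition cpair_wf B cp : Prop :=
  [/\ cp_F cp \in B, cp_G cp \in B, (cp_u cp).1 != 0, (cp_v cp).1 != 0 &
      llt (lmul (mono (cp_v cp)) (cp_G cp)) (lmul (mono (cp_u cp)) (cp_F cp))].

Lemma crit_pair_wf B F G :
  F \in B -> G \in B -> Num F <> Num G -> Poly F != 0 -> Poly G != 0 ->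
  cpair_wf B (crit_pair F G).
Proof.
move=> FB GB ne F0 G0; rewrite /crit_pair.
case: ifPn => lt; split; rewrite //= ?invr_neq0 ?lc_neq0 //.
move: lt; set x := lmul _ G; set y := lmul _ F.
rewrite /llt negb_or; case/andP=> nxy.
have := slt_total (Sign x) (Sign y); rewrite (negPf nxy) /=.
case/orP=> [->//|/eqP ->]; rewrite eqxx /= -leqNgt => le_n.
rewrite ltn_neqAle [in X in _ || X]le_n andbT; apply/orP; right.
by apply/eqP=> e; apply: ne.
Qed.

Definition st_wf st : Prop :=
  (forall F, F \in st_B st -> labeled F /\ (Num F <= st_k st)%N) /\
  (forall cp, cp \in st_CP st -> cpair_wf (st_B st) cp).

Lemma st_wf_init : (forall i, f i != 0) -> st_wf f5m_init.
Proof.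
move=> f0; split=> [F /imfsetP[i _ ->]|cp /imfset2P[i _ [j]]] /=.
  by split; [exact: labeled_init | exact: ltn_ord].
rewrite inE /= => ij ->; apply: crit_pair_wf => //=; try by rewrite in_imfset.
by case=> e; rewrite e ltnn in ij.
Qed.

Lemma cpair_wf_spoly B cp :
  (forall G, G \in B -> labeled G) -> cpair_wf B cp ->
  ~ rewritten_criterion B cp -> labeled (spoly cp).
Proof.
move=> LB [FB GB u0 v0 lt] nrew.
apply: labeled_lsub; try by apply: labeled_lmul => //; exact: LB.
case/orP: lt => // /andP[/eqP e ltN]; case: nrew; left; exists (cp_G cp) => //.
have e1 : (lpp (mono (cp_v cp)) + (Sign (cp_G cp)).1)%MM
  = (lpp (mono (cp_u cp)) + (Sign (cp_F cp)).1)%MM := congr1 fst e.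
have e2 : (Sign (cp_G cp)).2 = (Sign (cp_F cp)).2 := congr1 snd e.
by split=> //; rewrite -(lpp_mono u0) -e1 lem_addl.
Qed.

Lemma cpair_wf_sub B P cp : cpair_wf B cp -> cpair_wf (P |` B) cp.
Proof. by case=> FB GB *; split; rewrite // in_fset1U ?FB ?GB orbT. Qed.

Lemma st_wf_step st st' : f5m_step st st' -> st_wf st -> st_wf st'.
Proof.
case=> {st st'} [B D CP k cp cpC _|B D CP k cp R cpC _ nrew [redR _] P] [] /= LB LC.
  by split=> //= cp'; rewrite in_fsetD1 => /andP[_]; exact: LC.
have LB1 G : G \in B -> labeled G by case/LB.
have LR : labeled R.
  exact: labeled_f5_red LB1 redR (cpair_wf_spoly LB1 (LC _ cpC) nrew).
have wfP cp' : cp' \in CP -> cpair_wf (P |` B) cp'.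
  by move=> /LC; exact: cpair_wf_sub.
split=> /= [F|cp']; rewrite ?in_fset1U.
  by case/orP=> [/eqP->//|/LB[? /leqW]].
case: ifPn => [P0|_]; last by rewrite in_fsetD1 => /andP[_]; exact: wfP.
rewrite in_fsetU in_fsetD1 => /orP[/andP[_]|]; first exact: wfP.
case/imfsetP=> Q; rewrite inE /= => /andP[QB Q0] ->.
apply: crit_pair_wf => //; rewrite ?in_fset1U ?eqxx ?QB ?orbT //=.
by case: (LB _ QB) => _ /[swap] <-; rewrite ltnn.
Qed.

(* The labeled polynomials produced by the algorithm belong to L[X]. *)
Lemma f5m_output_labeled B F :
  (forall i, f i != 0) -> f5m_output B -> F \in B -> labeled F.
Proof.
move=> f0 [st run [_ <-]].
suff : st_wf st by case=> /[swap] _ /[apply] -[].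
suff: st_wf f5m_init -> st_wf st by apply; exact: st_wf_init.
elim: run => [x y /st_wf_step|//|x y z _ IH1 _ IH2 /IH1/IH2]; exact.
Qed.

End F5M.

(* Main.v *)
Require Import Defs.
From mathcomp Require Import all_boot all_order all_algebra.
From mathcomp Require Import finmap mpoly.
From Stdlib Require Import Relations.Relation_Operators.

(* [Defs] again, so that [Poly] is the projection and not [poly.Poly]. *)
Import Defs GRing.Theory.

Local Open Scope ring_scope.

(** Let [h] be a vector with [sigma h = Poly (c x^gamma F)] and leading power
    product [S = Sign (c x^gamma F)], of index [i], and let [G] be the witness of
    new-comparability. If [x^lambda lpp(f_i) G] has signature below [S], the
    principal syzygy [x^lambda (g e_i - f_i hG)], where [sigma hG = g = Poly G],
    has leading power product [S], and subtracting a multiple of it from [h]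
    cancels the leading term of [h]. Otherwise [x^lambda lpp(f_i) G] has signature
    [S], and subtracting a multiple of its own vector does so, at the price of one
    further summand that is a multiple of [G]. The remaining vector has all its
    terms below [S], and the initial polynomials turn it into a strictly lower
    representation. *)

Lemma init_lpoly_in_output {n m : nat} {K : fieldType} {le : rel 'X_{1..n}}
    {f : 'I_m -> {mpoly K[n]}} {B : {fset lpoly n m K}} :
  f5m_output le f B -> forall i, init_lpoly f i \in B.
Proof.
case=> st run [_ <-] i.
have grow st1 st2 : f5m_step le f st1 st2 ->
    init_lpoly f i \in st_B st1 -> init_lpoly f i \in st_B st2.
  by case=> //= *; rewrite in_fset1U; apply/orP; right.
suff: init_lpoly f i \in st_B (f5m_init le f) -> init_lpoly f i \in st_B st.
  by apply; rewrite /= in_imfset.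
elim: run => [x y /grow //|//|x y z _ IH1 _ IH2 /IH1/IH2 //].
Qed.

Section LowerVectors.

Context {n m : nat} {K : fieldType} {le : rel 'X_{1..n}}.
Context {f : 'I_m -> {mpoly K[n]}}.
Hypothesis le_adm : admissible_order le.

Implicit Types (h : 'I_m -> {mpoly K[n]}) (S t : signature n m).

Lemma lpp_mpolyX (a : 'X_{1..n}) : lpp le ('X_[a] : {mpoly K[n]}) = a.
Proof.
have := @lpp_mono n K le le_adm (1, a) (oner_neq0 _).
by rewrite /mono scale1r.
Qed.

Lemma slt_lpp (p : {mpoly K[n]}) (i : 'I_m) (a c : 'X_{1..n}) :
  a \in msupp p -> a <> lpp le p ->
  slt le f ((c + a)%MM, i) ((c + lpp le p)%MM, i).
Proof.
move=> ap /eqP ne; have p0 : p != 0.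
  by apply: contraTneq ap => ->; rewrite msupp0.
rewrite /slt /= -!addmA ![(_ + lpp le (f i))%MM]addmC.
have lt : mlt le a (lpp le p) by rewrite /mlt ne (lpp_prop le_adm p0).2.
by rewrite (mltD le_adm c (mltD le_adm _ lt)).
Qed.

(** Both vectors have all other terms below [S], so it suffices to cancel the coefficient at [S];
    [d] is the ratio of the two leading coefficients. *)
Lemma cancel_lead h h' S :
  is_lead le f h S -> is_lead le f h' S ->
  exists d : K, forall t, t.1 \in msupp (h t.2 - d *: h' t.2) -> slt le f t S.
Proof.
move=> [Sh lth] [Sh' lth'].
exists ((h S.2)@_S.1 / (h' S.2)@_S.1) => t.
case: (eqVneq t S) => [->|/eqP ne].
  rewrite mcoeff_msupp mcoeffB mcoeffZ divfK ?subrr ?eqxx //.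
  by rewrite -mcoeff_msupp.
move/msuppB_le; rewrite mem_cat => /orP[th|/msuppZ_le th]; first exact: lth.
exact: lth'.
Qed.

(** The terms of ['X_[a] * (f i * h j)] are at most [a + lpp (f i)] times [Sign G], which [lt] puts
    below [S]. Only the component at [i] can reach [S], through the leading term of [Poly G]. *)
Lemma is_lead_principal_syzygy h (G : lpoly n m K) (i : 'I_m)
    (a : 'X_{1..n}) :
  Poly G != 0 -> is_lead le f h (Sign G) ->
  slt le f ((a + lpp le (f i) + (Sign G).1)%MM, (Sign G).2)
           ((a + lpp le (Poly G))%MM, i) ->
  is_lead le f
    (fun j => 'X_[a] * (Poly G *+ (j == i) - f i * h j))
    ((a + lpp le (Poly G))%MM, i).
Proof.
move=> G0 [_ ltG] lt; set S := (_, i) in lt *.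
have lt_fh t : t.1 \in msupp ('X_[a] * (f i * h t.2)) -> slt le f t S.
  case: t => b j /= /msuppM_le/allpairsP[[x y] /=].
  rewrite msuppX inE => -[/eqP-> /msuppM_le/allpairsP[[y1 y2] /= [y1f y2h ->]] ->].
  have lt1 t : t = (y2, j) ->
      slt le f ((a + lpp le (f i) + t.1)%MM, t.2) S.
    move=> tE; case: (eqVneq t (Sign G)) => [->//|/eqP ne].
    apply: (slt_trans le_adm _ lt); apply: (sltD le_adm).
    by apply: ltG ne; rewrite tE.
  have := lt1 _ erefl; rewrite /= => lt2.
  case: (eqVneq y1 (lpp le (f i))) => [->|/eqP ne]; first by rewrite addmA.
  apply: (slt_trans le_adm _ lt2).
  (* Both sides are brought to the form [(a + y2) + _], which leaves [y1] against [lpp (f i)]. *)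
  rewrite addmA [(a + y1)%MM]addmC -addmA addmC.
  rewrite [(a + lpp _ _)%MM]addmC -[(lpp _ _ + a + y2)%MM]addmA [(lpp _ _ + (a + y2))%MM]addmC.
  exact: slt_lpp.
split=> [|[b j]] /=.
  rewrite eqxx mulr1n mulrBr mcoeff_msupp mcoeffB.
  rewrite [X in _ - X]memN_msupp_eq0; last first.
    by apply/negP=> /(lt_fh S); rewrite slt_irr.
  rewrite subr0 [_ * Poly G]mulrC mcoeffMX.
  exact: lc_neq0.
rewrite mulrBr => /msuppB_le; rewrite mem_cat => /orP[|th _]; last exact: lt_fh (b, j) th.
case: (eqVneq j i) => [->|_]; last by rewrite mulr0n mulr0 msupp0.
rewrite mulr1n => /msuppM_le/allpairsP[[x y] /=].
rewrite msuppX inE => -[/eqP-> yG ->] ne.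
by apply: slt_lpp => // yE; apply: ne; rewrite yE.
Qed.

(** Since [init_lpoly f i] has signature [(0, i)], its multiple by [h i] has as signature a term of
    [h]. Index [ord0] is kept for [G]. *)
Lemma lower_vector_representation {B : {fset lpoly n m K}} {F G : lpoly n m K}
    {h} {p : {mpoly K[n]}} :
  (forall i, init_lpoly f i \in B) -> G \in B ->
  Poly F = p * Poly G + sigma f h ->
  (p != 0 -> llt le f (lmul le p G) F) ->
  (forall t, t.1 \in msupp (h t.2) -> slt le f t (Sign F)) ->
  strictly_lower_representation le f B F.
Proof.
move=> initB GB FE pG hF.
exists m.+1, (fun j => oapp h p (unlift ord0 j)).
exists (fun j => oapp (init_lpoly f) G (unlift ord0 j)).
split=> [j||j]; first by case: (unliftP ord0 j) => [i|] _ /=.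
  rewrite FE big_ord_recl unlift_none /= /sigma. congr (_ + _).
  by apply: eq_bigr => i _; rewrite liftK.
case: unliftP => [i _|_] //= hi0; apply/orP; left; rewrite /= addm0.
by apply: hF; rewrite (lpp_prop le_adm hi0).1.
Qed.

End LowerVectors.

Theorem proposition5p2 (n m : nat) (K : fieldType)
    (le : rel 'X_{1..n}) (le_adm : admissible_order le)
    (f : 'I_m -> {mpoly K[n]}) (f_neq0 : forall i, f i != 0)
    (Bend : {fset lpoly n m K}) (Bend_out : f5m_output le f Bend)
    (F : lpoly n m K) (F_in : F \in Bend)
    (c : K) (gamma : 'X_{1..n}) (c_neq0 : c != 0) :
  new_comparable le f Bend (c, gamma) F ->
  strictly_lower_representation le f Bend (lmul le (mono (c, gamma)) F).
Proof.
case=> G G_in [G0 /= dvd lt].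
have labB := f5m_output_labeled le_adm f_neq0 Bend_out.
have initB := init_lpoly_in_output Bend_out.
have [h [hF hS]] : labeled le f (lmul le (mono (c, gamma)) F).
  by apply: labeled_lmul => //; exact: labB.
set S := Sign _ in hS; set i := (Sign F).2 in lt.
set a := (gamma + (Sign F).1 - lpp le (Poly G))%MM in lt.
(* Divisibility makes the truncated subtraction in [a] exact. *)
have SE : S = ((a + lpp le (Poly G))%MM, i).
  by rewrite /S /= lpp_mono // submK.
case/orP: (lt) => [ltS|/andP[/eqP eqS _]].
  have [hG [hGG hGS]] := labB _ G_in.
  move: ltS; rewrite -[X in slt _ _ _ X]/S SE /= lpp_mpolyX // => ltS.
  have lead_syz := is_lead_principal_syzygy le_adm _ _ _ _ G0 hGS ltS.
  rewrite -SE in lead_syz.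
  have [d hd] := cancel_lead _ _ _ hS lead_syz.
  (* The syzygy is killed by [sigma], so no multiple of [G] is needed. *)
  apply: (lower_vector_representation le_adm (p := 0)
    (h := fun j => h j - d *: ('X_[a] * (Poly G *+ (j == i) - f i * hG j)))
    initB G_in _ _ hd).
    rewrite mul0r add0r -hF /sigma.
    under [RHS]eq_bigr do rewrite mulrBl -scalerAl.
    rewrite sumrB -scaler_sumr -[LHS]subr0; congr (_ - _).
    under eq_bigr do rewrite -mulrA mulrBl -mulrA.
    rewrite -mulr_sumr sumrB -mulr_sumr -[\sum_j hG j * f j]/(sigma f hG) hGG.
    rewrite (bigD1 i) //= eqxx mulr1n big1 ?addr0.
      by rewrite [f i * _]mulrC subrr mulr0 scaler0.
    by move=> j /negPf->; rewrite mul0r.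
  by rewrite eqxx.
pose b := (a + lpp le (f i))%MM.
have [hG [hGG hGS]] : labeled le f (lmul le (mono (1, b)) G).
  by apply: labeled_lmul; [exact: le_adm|exact: oner_neq0|exact: labB].
rewrite /mono scale1r /= in hGG; rewrite /mono scale1r eqS -/S in hGS.
have [d hd] := cancel_lead _ _ _ hS hGS.
apply: (lower_vector_representation le_adm (p := d *: 'X_[b])
  (h := fun j => h j - d *: hG j) initB G_in _ _ hd).
  rewrite -hF /sigma.
  under [X in _ + X]eq_bigr do rewrite mulrBl -scalerAl.
  rewrite sumrB -scaler_sumr -[\sum_j hG j * f j]/(sigma f hG) hGG.
  by rewrite -scalerAl addrC subrK.
(* A nonzero scalar [d] changes neither signature nor number, so [lt] still applies. *)
rewrite scaler_eq0 negb_or => /andP[d0 _].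
move: lt; rewrite /lmul /llt /= lpp_mpolyX //.
by rewrite (lpp_mono le_adm (u := (d, b)) d0).
Qed.
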